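(* Let $V,\tau,\rho,\mu,r,h,K,d$, the constants $K_1,K_2,K_3$ and the functions $A,B$ be as in the context, and for $\lambda\ge0$ let $$G(\lambda)=\frac{K_1+\frac{K_2}{2\mu\rho}A(\lambda)+\frac{h}{4\mu\rho}B(\lambda)}{K_3+\frac{A(\lambda)}{2\mu\rho}}.$$ Let $\lambda^*=\frac{(K_1-K_2K_3)^+}{K_3h}$. Then $G$ is an absolutely continuous unimodal function on $[0,\infty)$ with a minimizer in $[0,\lambda^*]$.
   Context: Notation: $a^+=\max\{a,0\}$. On a probability space $(\Omega,\mathcal F,P)$ with a filtration $\mathbb F$ satisfying the usual conditions, $J=(J_t)_{t\ge0}$ is a subordinator with respect to $\mathbb F$ (adapted, nondecreasing, right-continuous, $J_0=0$, stationary increments, $J_{t+s}-J_t$ independent of $\mathcal F_t$) with Lévy measure $\nu$ and finite mean $\rho=EJ_1$; $\tau$ is an $\mathbb F$-stopping time with $E\tau<\infty$ and $V:=J_\tau>0$ a.s., and $EV^2<\infty$. Let $\mu=\frac{1}{2\rho}\int_{(0,\infty)}x^2\nu(dx)$, with $0<\mu<\infty$. The constants $h,K,d\in(0,\infty)$ are a holding cost rate, a setup cost and an output capacity cost rate, and $\rho<r<\infty$ is a maximal output rate. $\tilde Z^\tau$ denotes the steady-state distribution of the workload restricted to off periods, so that $E\tau\,E\tilde Z^\tau=E\int_0^\tau J_t\,dt$. Define $$K_1=hE\tau E\tilde Z^\tau+K+\left[d+\frac{d\rho}{r-\rho}+\frac{h\mu\rho}{(r-\rho)^2}\right]EV+\frac{h}{2(r-\rho)}EV^2,$$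 $$K_2=d\rho+\frac{2h\mu\rho}{r-\rho},\qquad K_3=E\tau+\frac{EV}{r-\rho},$$ and, for $\lambda\ge0$, $$A(\lambda)=E\left[V\left(\lambda-\frac V2\right)^+\right],\qquad B(\lambda)=E\left\{V\left[\lambda^2-\left(\frac V2\right)^2\right]^+\right\}.$$ A function on $[0,\infty)$ is unimodal (in the sense relevant to minimization) if there is $m\ge0$ such that it is nonincreasing on $[0,m]$ and nondecreasing on $[m,\infty)$. *)

(* Defs.v *)
From HB Require Import structures.
From mathcomp Require Import all_boot all_order all_algebra.
From mathcomp Require Import all_classical all_reals all_analysis.

Set Implicit Arguments.
Unset Strict Implicit.
Unset Printing Implicit Defensive.

Import Order.TTheory GRing.Theory Num.Theory.
Import numFieldNormedType.Exports.

Local Open Scope classical_set_scope.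
Local Open Scope ring_scope.

(* Continuous time is [0, +oo[: indices t < 0 are never constrained nor used. *)
Record usual_filtration d (T : measurableType d) (R : realType)
    (P : probability T R) (F : R -> set (set T)) : Prop := {
  filtration_sigma_algebra : forall t : R, 0 <= t -> sigma_algebra setT (F t) ;
  filtration_measurable : forall t : R, 0 <= t -> F t `<=` measurable ;
  filtration_nondecreasing : forall s t : R, 0 <= s -> s <= t -> F s `<=` F t ;
  filtration_right_continuous : forall t : R, 0 <= t ->
    \bigcap_(s in [set` `]t, +oo[]) F s `<=` F t ;
  filtration_complete : P.-negligible `<=` F 0 }.

Record subordinator d (T : measurableType d) (R : realType)
    (P : probability T R) (F : R -> set (set T)) (J : R -> T -> R) : Prop := {
  subordinator_adapted : forall t : R, 0 <= t ->
    forall B : set R, measurable B -> F t (J t @^-1` B) ;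
  subordinator_nondecreasing : forall w (s t : R),
    0 <= s -> s <= t -> J s w <= J t w ;
  subordinator_right_continuous : forall w (t : R),
    0 <= t -> J s w @[s --> t^'+] --> J t w ;
  subordinator_start : forall w, J 0 w = 0 ;
  subordinator_stationary : forall t s : R, 0 <= t -> 0 <= s ->
    forall B : set R, measurable B ->
      P ((J (t + s) \- J t) @^-1` B) = P ((J s \- J 0) @^-1` B) ;
  subordinator_independent : forall t s : R, 0 <= t -> 0 <= s ->
    forall (A : set T) (B : set R), F t A -> measurable B ->
      P (A `&` (J (t + s) \- J t) @^-1` B)
      = (P A * P ((J (t + s)%R \- J t)%R @^-1` B))%E }.

(* nu is the jump measure in the Levy-Khintchine representation
   E exp(- a J_t) = exp(- t (c a + int_(0,oo) (1 - e^(- a x)) nu(dx))),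
   where c >= 0 is the drift of J. *)
Definition levy_measure d (T : measurableType d) (R : realType)
    (P : probability T R) (J : R -> T -> R)
    (nu : {measure set (measurableTypeR R) -> \bar R}) : Prop :=
  [/\ nu [set` `]-oo, 0]] = 0%E,
      (\int[nu]_(x in [set` `]0%R, +oo[]) (Num.min x 1)%:E < +oo)%E
    & exists2 c : R, 0 <= c &
      forall t a : R, 0 <= t -> 0 <= a ->
        ('E_P[fun w => expR (- (a * J t w))]
         = (expR (- (t * (c * a + fine
             (\int[nu]_(x in [set` `]0%R, +oo[]) (1 - expR (- (a * x)))%:E)))))%:E)%E].

Definition stopping_time d (T : measurableType d) (R : realType)
    (F : R -> set (set T)) (tau : T -> \bar R) : Prop :=
  (forall w, 0 <= tau w)%E /\
  (forall t : R, 0 <= t -> F t [set w | (tau w <= t%:E)%E]).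

(* J_tau.  Where tau = +oo this is J 0 (as fine +oo = 0); below E tau < +oo,
   so that this convention concerns a null event only. *)
Definition stopped (T : Type) (R : realType) (J : R -> T -> R)
    (tau : T -> \bar R) (w : T) : R := J (fine (tau w)) w.

(* An off period starts with an empty system and lasts tau, its workload being
   J_t for t < tau.  The steady-state law of the workload restricted to off
   periods is the normalized expected occupation measure
   B |-> E [int_0^tau 1_B(J_t) dt] / E tau. *)
Definition off_period_law d (T : measurableType d) (R : realType)
    (P : probability T R) (J : R -> T -> R) (tau : T -> \bar R)
    (zeta : probability (measurableTypeR R) R) : Prop :=
  forall B : set (measurableTypeR R), measurable B ->
    (zeta B = ((fine (\int[P]_w tau w))^-1)%:E *
      \int[P]_w \int[@lebesgue_measure R]_(t in
                   [set t : R | (0 <= t)%R /\ (t%:E < tau w)%E])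
                  (\1_B (J t w))%:E)%E.

(* Used only for expectations that are finite under the hypotheses of the
   theorem. *)
Definition mean d (T : measurableType d) (R : realType) (P : probability T R)
    (X : T -> R) : R := fine 'E_P[X].

Definition pos_part (R : realType) (a : R) : R := Num.max a 0.

Section model.
Context disp (T : measurableType disp) (R : realType) (P : probability T R).
Context (V : T -> R) (tau : T -> \bar R).
Context (zeta : probability (measurableTypeR R) R).
Context (rho mu r h K d : R).

Let Etau : R := fine (\int[P]_w tau w)%E.
Let EZ : R := mean zeta (fun x => x).
Let EV : R := mean P V.
Let EV2 : R := mean P (fun w => V w ^+ 2).

Definition K1 : R :=
  h * Etau * EZ + K
  + (d + d * rho / (r - rho) + h * mu * rho / (r - rho) ^+ 2) * EV
  + h / (2 * (r - rho)) * EV2.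

Definition K2 : R := d * rho + 2 * h * mu * rho / (r - rho).

Definition K3 : R := Etau + EV / (r - rho).

Definition A (la : R) : R := mean P (fun w => V w * pos_part (la - V w / 2)).

Definition B (la : R) : R :=
  mean P (fun w => V w * pos_part (la ^+ 2 - (V w / 2) ^+ 2)).

Definition G (la : R) : R :=
  (K1 + K2 / (2 * mu * rho) * A la + h / (4 * mu * rho) * B la)
  / (K3 + A la / (2 * mu * rho)).

Definition lambda_star : R := pos_part (K1 - K2 * K3) / (K3 * h).

End model.

(* D is meant to be an interval. *)
Definition absolutely_continuous_on (R : realType) (D : set R) (f : R -> R) :
    Prop :=
  forall e : R, 0 < e -> exists2 dl : R, 0 < dl &
    forall (n : nat) (a b : 'I_n -> R),
      (forall i, [/\ a i <= b i, D (a i) & D (b i)]) ->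
      trivIset setT (fun i => [set` `]a i, b i[]) ->
      \sum_(i < n) (b i - a i) < dl ->
      \sum_(i < n) `|f (b i) - f (a i)| < e.

Definition unimodal (R : realType) (f : R -> R) : Prop :=
  exists m : R, [/\ 0 <= m,
    {in `[0, m] &, nonincreasing_fun f} &
    {in `[m, +oo[ &, nondecreasing_fun f}].

(* Main.v *)
(* With D the denominator and N the numerator of G, put
   S(x) = (K2 + h x) D(x) - N(x) and k = 1 / (2 mu rho).  Formally
   G' = k A' S / D^2, and S is increasing with slope at least h K3, so that G
   turns once, at a zero of S (or at 0 when S(0) >= 0), which lies below
   (- S(0))^+ / (h K3) = lambda_star, as S(0) = K2 K3 - K1.  Derivatives are
   avoided: the increments over [x, y] satisfy 2 x dA <= dB <= 2 y dA, whence
   k dA S(x) <= (G(y) - G(x)) D(x) D(y) <= k dA S(y).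
   G is even Lipschitz on [0, +oo[: B grows quadratically, but G(x) is O(1 + x)
   and, as A(y) >= y E[V] - E[V^2] / 2, y / D(y) stays bounded. *)
Require Import Defs.
From HB Require Import structures.
From mathcomp Require Import all_boot all_order all_algebra.
From mathcomp Require Import all_classical all_reals all_analysis.
From mathcomp Require Import measurable_realfun.
From mathcomp Require Import ring lra.

Set Implicit Arguments.
Unset Strict Implicit.
Unset Printing Implicit Defensive.

Import Order.TTheory GRing.Theory Num.Theory.
Import numFieldNormedType.Exports.

Local Open Scope classical_set_scope.
Local Open Scope ring_scope.

(** * Calculus of an abstract ratio with controlled increments *)

Section cost_ratio.
Context (R : realType) (A B : R -> R) (k c1 c2 c3 h v s : R).
Hypotheses (k_gt0 : 0 < k) (c2_ge0 : 0 <= c2) (c3_gt0 : 0 < c3) (h_gt0 : 0 < h).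
Hypotheses (v_gt0 : 0 < v) (s_ge0 : 0 <= s).
Hypotheses (A0 : A 0 = 0) (B0 : B 0 = 0).
Implicit Types x y : R.
Hypothesis A_incr : forall x y, 0 <= x -> x <= y ->
  0 <= A y - A x <= v * (y - x).
Hypothesis B_incr : forall x y, 0 <= x -> x <= y ->
  2 * x * (A y - A x) <= B y - B x <= 2 * y * (A y - A x).
Hypothesis A_lb : forall x, 0 <= x -> v * x - s <= A x.

Let N x := c1 + c2 * k * A x + h / 2 * k * B x.
Let D x := c3 + k * A x.
Let G x := N x / D x.
Let S x := (c2 + h * x) * D x - N x.

Let A_ge0 x : 0 <= x -> 0 <= A x.
Proof.
by move=> x0; have := A_incr (lexx 0) x0; rewrite A0 subr0 => /andP[].
Qed.

Let D_ge x : 0 <= x -> c3 <= D x.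
Proof. by move=> x0; rewrite lerDl mulr_ge0 ?A_ge0// ltW. Qed.

Let D_gt0 x : 0 <= x -> 0 < D x.
Proof. by move=> x0; exact: lt_le_trans c3_gt0 (D_ge x0). Qed.

(** Write d for increments over [x, y]. The numerator of [G y - G x] is [dN * D x - N x * dD], and
    also [dN * D y - N y * dD]. As [dD = k dA] and [dN] lies between [k dA (c2 + h x)] and
    [k dA (c2 + h y)], the first form gives the lower bound and the second the upper one. *)
Let G_incr_bounds x y : 0 <= x -> x <= y ->
  k * (A y - A x) * S x <= (G y - G x) * (D x * D y)
                        <= k * (A y - A x) * S y.
Proof.
move=> x0 xy; have y0 := le_trans x0 xy.
have Dx := D_gt0 x0; have Dy := D_gt0 y0.
have -> : (G y - G x) * (D x * D y) = (N y - N x) * D x - N x * (D y - D x).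
  by rewrite /G; field; rewrite !gt_eqF.
have /andP[Bl Bu] := B_incr x0 xy.
have hk : 0 <= h / 2 * k by rewrite !mulr_ge0// ?ltW//; lra.
have := ler_wpM2l hk Bl; have := ler_wpM2l hk Bu => {Bl Bu} Bu Bl.
have Nl : k * (A y - A x) * (c2 + h * x) <= N y - N x by rewrite /N; lra.
have Nu : N y - N x <= k * (A y - A x) * (c2 + h * y) by rewrite /N; lra.
have DE : D y - D x = k * (A y - A x) by rewrite /D; ring.
apply/andP; split.
  have := ler_wpM2r (ltW Dx) Nl; rewrite DE /S; lra.
have -> : (N y - N x) * D x - N x * (D y - D x) =
          (N y - N x) * D y - N y * (D y - D x) by ring.
by have := ler_wpM2r (ltW Dy) Nu; rewrite DE /S; lra.
Qed.

(** The [c2] terms cancel and leave [h (y D y - x D x) - (h / 2) k (B y - B x)]. The upper bound on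
    the increment of [B] leaves at least [h (y - x) D x], the lower one at most [h (y - x) D y]. *)
Let S_incr_bounds x y : 0 <= x -> x <= y ->
  h * c3 * (y - x) <= S y - S x <= h * D y * (y - x).
Proof.
move=> x0 xy; have y0 := le_trans x0 xy.
have /andP[Bl Bu] := B_incr x0 xy; have /andP[A1 _] := A_incr x0 xy.
have hk0 : 0 <= h * k by rewrite mulr_ge0// ltW.
have hk : 0 <= h / 2 * k by lra.
have := ler_wpM2l hk Bl; have := ler_wpM2l hk Bu => {Bl Bu} Bu Bl.
have := mulr_ge0 hk0 (mulr_ge0 (A_ge0 x0) (_ : 0 <= y - x)).
rewrite subr_ge0 => /(_ xy) hA.
by apply/andP; split; rewrite /S /N /D; lra.
Qed.

Let G_homo x y : 0 <= x -> x <= y -> 0 <= S x -> G x <= G y.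
Proof.
move=> x0 xy Sx; have y0 := le_trans x0 xy.
have DD : 0 < D x * D y by rewrite mulr_gt0 ?D_gt0.
have /andP[A1 _] := A_incr x0 xy.
rewrite -subr_ge0 -(pmulr_lge0 _ DD).
have /andP[+ _] := G_incr_bounds x0 xy; apply: le_trans.
by rewrite !mulr_ge0// ltW.
Qed.

Let G_nhomo x y : 0 <= x -> x <= y -> S y <= 0 -> G y <= G x.
Proof.
move=> x0 xy Sy; have y0 := le_trans x0 xy.
have DD : 0 < D x * D y by rewrite mulr_gt0 ?D_gt0.
have /andP[A1 _] := A_incr x0 xy.
rewrite -subr_le0 -(pmulr_lle0 _ DD).
have /andP[_ /le_trans] := G_incr_bounds x0 xy; apply.
by rewrite mulr_ge0_le0// mulr_ge0// ltW.
Qed.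

Let S_homo x y : 0 <= x -> x <= y -> S x <= S y.
Proof.
move=> x0 xy; have /andP[+ _] := S_incr_bounds x0 xy.
rewrite -[S x <= _]subr_ge0; apply: le_trans.
by rewrite !mulr_ge0 ?subr_ge0// ltW.
Qed.

Let S0 : S 0 = c2 * c3 - c1.
Proof. by rewrite /S /N /D A0 B0; ring. Qed.

(** The slope bound [h * D y] depends on [y]; on [0, b] monotonicity of [D] replaces it by the
    constant [h * D b]. *)
Let S_continuous b : 0 <= b -> {within `[0, b], continuous S}.
Proof.
move=> b0; set M := h * D b.
have M0 : 0 < M by rewrite mulr_gt0 ?D_gt0.
have S_lip x y : 0 <= x -> x <= y -> y <= b -> `|S y - S x| <= M * (y - x).
  move=> x0 xy yb; have /andP[_ +] := S_incr_bounds x0 xy.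
  rewrite ger0_norm ?subr_ge0 ?S_homo// => /le_trans; apply.
  rewrite ler_wpM2r ?subr_ge0// ler_wpM2l ?(ltW h_gt0)//.
  rewrite lerD2l ler_wpM2l ?(ltW k_gt0)//.
  by have /andP[+ _] := A_incr (le_trans x0 xy) yb; rewrite subr_ge0.
apply/subspace_continuousP => x /=; rewrite in_itv/= => /andP[x0 xb].
apply/cvgrPdist_le => e e0; near=> y.
have : y \in `[0, b] by near: y; exact: withinT.
rewrite in_itv/= => /andP[y0 yb].
have xye : `|x - y| <= e / M.
  near: y; apply: cvg_within; apply: (@cvgr_dist_le _ _ _ (nbhs x)) => //.
  by rewrite divr_gt0.
have [yx|/ltW xy] := leP y x.
  apply: le_trans (S_lip _ _ y0 yx xb) _.
  by rewrite -ler_pdivlMl// mulrC; move: xye; rewrite ger0_norm ?subr_ge0.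
rewrite distrC; apply: le_trans (S_lip _ _ x0 xy yb) _.
by rewrite -ler_pdivlMl// mulrC; move: xye; rewrite distrC ger0_norm ?subr_ge0.
Unshelve. all: end_near. Qed.

(** This is [lambda_star] once [c1], [c2], [c3] stand for [K1], [K2], [K3]. *)
Let L := Num.max (c1 - c2 * c3) 0 / (c3 * h).

Let L_ge0 : 0 <= L.
Proof.
by rewrite divr_ge0 ?mulr_ge0 ?(ltW h_gt0) ?(ltW c3_gt0)// le_max lexx orbT.
Qed.

Lemma exists_turning_point : exists2 m, 0 <= m <= L &
  {in `[0, m] &, nonincreasing_fun G} /\ {in `[m, +oo[ &, nondecreasing_fun G}.
Proof.
(* As [S] is nondecreasing, [S m = 0] makes [S] nonpositive on [0, m], and [0 <= S m] makes it
   nonnegative beyond [m]. If [m = 0], the left interval is a point and [S m] may be positive. *)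
suff [m /andP[m0 mL] [Sl Sr]] :
    exists2 m, 0 <= m <= L & (m = 0 \/ S m = 0) /\ 0 <= S m.
  exists m; first by rewrite m0.
  split=> x y; rewrite !in_itv/= ?andbT.
    move=> /andP[x0 xm] /andP[y0 ym] xy; case: Sl => [m00|Sm].
      suff -> : x = y by [].
      by apply/eqP; rewrite eq_le xy/= (le_trans ym)// m00.
    by apply: G_nhomo => //; rewrite -Sm; apply: S_homo.
  move=> mx my xy; apply: G_homo => //; first exact: le_trans mx.
  by apply: le_trans Sr _; exact: S_homo.
have [c|c] := leP 0 (S 0); first by exists 0; [rewrite lexx|split; [left|]].
(* Here [S 0 < 0], so the positive part in [L] equals [c1 - c2 * c3], and the least slope [h * c3]
   over [0, L] accounts for a rise of exactly [- S 0]. *)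
have SL : 0 <= S L.
  have /andP[+ _] := S_incr_bounds (lexx 0) L_ge0.
  have -> : h * c3 * (L - 0) = - S 0.
    rewrite /L S0; move: c; rewrite S0 subr_lt0 => c.
    rewrite max_l ?subr_ge0 ?ltW//; field.
    by rewrite !gt_eqF.
  by rewrite -[X in X <= _ -> _]add0r lerD2r.
have [||m] := @IVT _ S 0 L 0 L_ge0; first exact: S_continuous.
  by rewrite ge_min ltW//= le_max SL orbT.
by rewrite in_itv/= => mL Sm; exists m => //; rewrite Sm; split => //; right.
Qed.

(** Over [x, y], [dG = (dN - G x * dD) / D y]. In absolute value both terms of the numerator are at
    most [k dA] times an affine function of [y], while 1 and [y] are bounded by multiples of
    [D y]. *)
Lemma cost_ratio_lipschitz : exists M, forall x y,
  0 <= x -> x <= y -> `|G y - G x| <= M * (y - x).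
Proof.
(* By [A_lb], [k v y <= k s + k A y]. Here [k A y <= D y], and [k s <= (k s / c3) D y] because
   [c3 <= D y]. *)
pose q := (1 + k * s / c3) / (k * v).
have D_lin y : 0 <= y -> y <= q * D y.
  move=> y0; rewrite /q mulrAC ler_pdivlMr ?mulr_gt0//.
  have := ler_wpM2l (ltW k_gt0) (A_lb y0).
  have ks : 0 <= k * s / c3 by rewrite !mulr_ge0 ?invr_ge0// ltW.
  have := ler_wpM2l ks (D_ge y0); rewrite divfK ?gt_eqF// => H1 H2.
  have DE : D y = c3 + k * A y by [].
  rewrite mulrDl mul1r; move: H1 H2 DE c3_gt0.
  by move: (D y) (k * s / c3) => Dy e; lra.
(* The bound on [N x] uses [|c1| <= (|c1| / c3) D x], [k A x <= D x], and [B x <= 2 x A x], the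
   increment bound for [B] started at 0. *)
pose b := `|c1| / c3 + c2.
have b0 : 0 <= b by rewrite addr_ge0// divr_ge0// ltW.
have G_bound x : 0 <= x -> `|G x| <= b + h * x.
  move=> x0; have Dx := D_gt0 x0.
  have := B_incr (lexx 0) x0; rewrite A0 B0 !subr0 mulr0 mul0r => /andP[B1 B2].
  have hk : 0 <= h / 2 * k by rewrite !mulr_ge0// ?ltW//; lra.
  have A1 := A_ge0 x0.
  have ck : 0 <= c2 * k by rewrite mulr_ge0// ltW.
  rewrite normrM normfV (gtr0_norm Dx) ler_pdivrMr//.
  have -> : N x = c1 + (c2 * k * A x + h / 2 * k * B x) by rewrite /N; ring.
  apply: (le_trans (ler_normD _ _)).
  rewrite [X in _ + X]ger0_norm; last by rewrite addr_ge0 // mulr_ge0.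
  have := ler_wpM2l hk B2.
  have n0 : 0 <= `|c1| / c3 by rewrite divr_ge0// ltW.
  have := ler_wpM2l n0 (D_ge x0); rewrite divfK ?gt_eqF// => H1 H2.
  have hx : 0 <= h * x * c3 by rewrite !mulr_ge0// ltW.
  have cc : 0 <= c2 * c3 by rewrite !mulr_ge0// ltW.
  by rewrite /b 2!mulrDl; move: H1; rewrite /D; lra.
(* The factor [k * v] comes from [dA <= v (y - x)]. The terms [b / c3 + h * q] bound
   [(b + h y) / D y], for [G x]; the terms [c2 / c3 + h * q] bound [(c2 + h y) / D y], for [dN]. *)
exists (k * v * (b / c3 + h * q + c2 / c3 + h * q)).
move=> x y x0 xy; have y0 := le_trans x0 xy.
have Dx := D_gt0 x0; have Dy := D_gt0 y0.
have /andP[A1 A2] := A_incr x0 xy.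
have -> : G y - G x = ((N y - N x) - G x * (D y - D x)) / D y.
  by rewrite /G; field; rewrite !gt_eqF.
have kA : 0 <= k * (A y - A x) by rewrite mulr_ge0// ltW.
have kAv : k * (A y - A x) <= k * v * (y - x) by rewrite -mulrA ler_wpM2l// ltW.
have DE : D y - D x = k * (A y - A x) by rewrite /D; ring.
have NE : `|N y - N x| <= k * (A y - A x) * (c2 + h * y).
  have /andP[B1 B2] := B_incr x0 xy.
  have hk : 0 <= h / 2 * k by rewrite !mulr_ge0// ?ltW//; lra.
  have B3 : 0 <= B y - B x by apply: le_trans B1; rewrite !mulr_ge0.
  have -> : N y - N x = c2 * (k * (A y - A x)) + h / 2 * k * (B y - B x).
    by rewrite /N; ring.
  rewrite ger0_norm; last by rewrite addr_ge0// mulr_ge0.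
  by have := ler_wpM2l hk B2; lra.
rewrite normrM normfV (gtr0_norm Dy) ler_pdivrMr//.
apply: (le_trans (ler_normB _ _)).
rewrite normrM DE (ger0_norm kA).
have GE : `|G x| * (k * (A y - A x)) <= k * (A y - A x) * (b + h * y).
  rewrite mulrC ler_wpM2l//; apply: le_trans (G_bound _ x0) _.
  by rewrite lerD2l ler_wpM2l// ltW.
apply: le_trans (lerD NE GE) _.
rewrite -mulrDr.
have c0 : 0 <= c2 + h * y + (b + h * y).
  by have := mulr_ge0 (ltW h_gt0) y0; move: b0 c2_ge0; lra.
apply: le_trans (ler_wpM2r c0 kAv) _.
rewrite [leRHS](_ : _ = k * v * (y - x) *
  ((b / c3 + h * q + c2 / c3 + h * q) * D y)); last by ring.
apply: ler_wpM2l; first by rewrite !mulr_ge0 ?subr_ge0// ltW.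
have bc : 0 <= (b + c2) / c3.
  by apply: divr_ge0; [exact: addr_ge0|exact: ltW].
have := ler_wpM2l bc (D_ge y0); rewrite divfK ?gt_eqF//.
by have := ler_wpM2l (ltW h_gt0) (D_lin _ y0); lra.
Qed.

End cost_ratio.

(** * From Lipschitz to absolutely continuous *)

Lemma lipschitz_absolutely_continuous_on (R : realType) (f : R -> R)
    (D : set R) (M : R) :
  (forall x y, D x -> D y -> x <= y -> `|f y - f x| <= M * (y - x)) ->
  absolutely_continuous_on D f.
Proof.
(* The maximum with 1 makes the divisor positive whatever the sign of [M]. *)
move=> f_lip e e0; pose M1 := Num.max M 1.
have M0 : 0 < M1 by rewrite lt_max ltr01 orbT.
exists (e / M1); first by rewrite divr_gt0.
move=> n a b ab _ abe.
apply: (@le_lt_trans _ _ (\sum_(i < n) M1 * (b i - a i))).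
  apply: ler_sum => i _; have [abi Da Db] := ab i.
  apply: le_trans (f_lip _ _ Da Db abi) _.
  by rewrite ler_wpM2r ?subr_ge0// le_max lexx.
by rewrite -mulr_sumr mulrC -ltr_pdivlMr.
Qed.

(** * Measurability and sign of the stopped process *)

Section stopped_process.
Context disp (T : measurableType disp) (R : realType) (P : probability T R).
Context (F : R -> set (set T)) (J : R -> T -> R) (tau : T -> \bar R).
Hypotheses (hF : usual_filtration P F) (hJ : subordinator P F J).
Hypothesis htau : stopping_time F tau.

Lemma measurable_stopping_time : measurable_fun setT tau.
Proof.
apply: (measurability _ (ErealGenOInfty.measurableE R)) => // _ [_ [x ->] <-].
rewrite setTI -[X in measurable X]setCK; apply: measurableC.
(* The filtration handles [0 <= x]; for negative [x] the preimage is the whole space because [tau]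
   is nonnegative. *)
have [x0|x0] := leP 0 x.
  apply: (filtration_measurable hF x0).
  suff -> : ~` (tau @^-1` `]x%:E, +oo[%classic) =
            [set w | (tau w <= x%:E)%E] by exact: htau.2.
  by apply/seteqP; split => w /=; rewrite in_itv/= andbT leNgt => /negP.
suff -> : tau @^-1` `]x%:E, +oo[%classic = setT by rewrite setCT.
apply/seteqP; split => // w _ /=; rewrite in_itv/= andbT.
by rewrite (lt_le_trans _ (htau.1 w))// lte_fin.
Qed.

Lemma measurable_subordinator (t : R) : 0 <= t -> measurable_fun setT (J t).
Proof.
move=> t0 _ B mB; rewrite setTI.
apply: (filtration_measurable hF t0).
exact: subordinator_adapted hJ _ t0 _ mB.
Qed.

(** Grid times decreasing the error to 0 from above reduce the claim to countably many fixed times;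
    right-continuity of the paths gives the pointwise limit. *)
Lemma measurable_stopped : measurable_fun setT (stopped J tau).
Proof.
pose sg w := fine (tau w).
have sg0 w : 0 <= sg w by rewrite fine_ge0// htau.1.
(* Adding 1 after truncation puts the grid time strictly above [sg w], as the sequential form of a
   right limit requires. *)
pose N n w := Num.truncn (sg w * n.+1%:R).
pose V n w := J ((N n w).+1%:R / n.+1%:R) w.
have sgN n w : sg w < (N n w).+1%:R / n.+1%:R <= sg w + n.+1%:R^-1.
  have /truncn_itv/andP[lo hi] : 0 <= sg w * n.+1%:R by rewrite mulr_ge0.
  rewrite ltr_pdivlMr// hi/= ler_pdivrMr// mulrDl mulVf// -natr1 lerD2r.
  exact: lo.
apply: (@measurable_fun_cvg _ _ _ _ V) => [n|w _]; last first.
  have Jr := subordinator_right_continuous hJ (w := w) (sg0 w).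
  apply: ((cvg_at_rightP (fun t => J t w) (sg w) (J (sg w) w)).1 Jr).
  split=> [n|]; first by case/andP: (sgN n w).
  apply: (@squeeze_cvgr _ _ _ _ (fun=> sg w) (fun n => sg w + n.+1%:R^-1)).
  - by apply: nearW => n; case/andP: (sgN n w) => /ltW -> ->.
  - exact: cvg_cst.
  - rewrite -[X in _ --> X]addr0.
    by apply: cvgD; [exact: cvg_cst|exact: cvg_harmonic].
move=> _ B mB; rewrite setTI.
(* On each event [N n w = k], [V n] is [J] at a deterministic time. *)
have -> : V n @^-1` B = \bigcup_k
    ([set w | N n w = k] `&` J (k.+1%:R / n.+1%:R) @^-1` B).
  apply/seteqP; split => [w Bw|w [k _ [/= <-]]//].
  by exists (N n w).
apply: bigcup_measurable => k _; apply: measurableI; last first.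
  rewrite -[X in measurable X]setTI; apply: measurable_subordinator => //.
have -> : [set w | N n w = k] =
    sg @^-1` `[k%:R / n.+1%:R, k.+1%:R / n.+1%:R[%classic.
  apply/seteqP; split => w /=; rewrite in_itv/= ler_pdivrMr// ltr_pdivlMr//.
    by move=> <-; apply: truncn_itv; rewrite mulr_ge0.
  by move/truncn_def.
rewrite -[X in measurable X]setTI.
suff msg : measurable_fun setT sg by exact: msg.
by apply: measurableT_comp measurable_stopping_time; exact: fine_measurable.
Qed.

Lemma stopped_ge0 w : 0 <= stopped J tau w.
Proof.
rewrite -(subordinator_start hJ w).
apply: (subordinator_nondecreasing hJ) => //.
by rewrite fine_ge0// htau.1.
Qed.

End stopped_process.

(** * Increment bounds for [A] and [B], first pointwise and then in mean *)

Lemma pos_part_incr (R : realType) (x y v : R) : x <= y ->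
  0 <= pos_part (y - v) - pos_part (x - v) <= y - x.
Proof.
move=> xy; rewrite /pos_part.
by have [] := leP (y - v) 0; have [] := leP (x - v) 0; lra.
Qed.

(** For [z >= 0] the positive part of [z ^+ 2 - v ^+ 2] is [z + v] times that of [z - v]. If
    [x <= v <= y], then [y + v] lies between [2 x] and [2 y]; if [v <= x], the same holds for
    [x + y]. *)
Lemma pos_part_sqr_incr (R : realType) (x y v : R) :
  0 <= x -> x <= y -> 0 <= v ->
  2 * x * (pos_part (y - v) - pos_part (x - v)) <=
  pos_part (y ^+ 2 - v ^+ 2) - pos_part (x ^+ 2 - v ^+ 2) <=
  2 * y * (pos_part (y - v) - pos_part (x - v)).
Proof.
move=> x0 xy v0.
have posE z : 0 <= z -> pos_part (z ^+ 2 - v ^+ 2) = (z + v) * pos_part (z - v).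
  by move=> z0; rewrite /pos_part subr_sqr mulrC maxr_pMr ?mulr0 ?addr_ge0.
rewrite !posE ?(le_trans x0 xy)// /pos_part.
have [] := leP (y - v) 0; have [] := leP (x - v) 0 => *; apply/andP; split; nra.
Qed.

Section moments.
Context disp (T : measurableType disp) (R : realType) (P : probability T R).
Implicit Types (f g : T -> R) (x y la : R).

Lemma mean_Rintegral f : mean P f = \int[P]_w f w.
Proof. by rewrite /mean unlock. Qed.

Context (V : T -> R).
Hypotheses (mV : measurable_fun setT V) (V_ge0 : forall w, 0 <= V w).
Hypothesis (V2_fin : ('E_P[fun w => (V w ^+ 2)%R] < +oo)%E).

Let intP f := P.-integrable setT (EFin \o f).

Let int_V2 : intP (fun w => V w ^+ 2).
Proof.
apply/integrableP; split.
  by apply/measurable_EFinP; exact: measurable_funX.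
move: V2_fin; rewrite unlock; apply: le_lt_trans.
rewrite le_eqVlt; apply/orP; left; apply/eqP; apply: eq_integral => w _ /=.
by rewrite ger0_norm// sqr_ge0.
Qed.

(** [V <= 1 + V ^+ 2], and constants are integrable under a probability. *)
Let int_V : intP V.
Proof.
have i1 : intP (fun=> 1) by exact: finite_measure_integrable_cst.
apply: (le_integrable measurableT _ _ (integrableD measurableT i1 int_V2)).
  exact/measurable_EFinP.
move=> w _ /=; rewrite lee_fin !ger0_norm ?addr_ge0 ?sqr_ge0//.
by have := sqr_ge0 (V w - 1); have := V_ge0 w; nra.
Qed.

(** The integrands of [A] and [B] are [V] times a factor at most [la], respectively [la ^+ 2], so
    the cubic term inside [B] never has to be integrated by itself. *)
Let int_le (c : R) f : measurable_fun setT f ->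
  (forall w, 0 <= f w <= c * V w) -> intP f.
Proof.
move=> mf fc; have cV := integrableZl measurableT c int_V.
apply: (le_integrable measurableT _ _ cV).
  exact/measurable_EFinP.
move=> w _ /=; have /andP[f0 fcw] := fc w.
by rewrite lee_fin ger0_norm// (le_trans fcw)// ler_norm.
Qed.

Let int_A la : 0 <= la -> intP (fun w => V w * pos_part (la - V w / 2)).
Proof.
move=> la0; apply: (@int_le la).
  apply: measurable_funM => //; apply: measurable_maxr => //.
  by apply: measurable_funB => //; apply: measurable_funM.
move=> w; have V0 := V_ge0 w; rewrite /pos_part.
rewrite mulr_ge0 ?le_max ?lexx ?orbT//= mulrC ler_wpM2r// ge_max la0 andbT.
by lra.
Qed.

Let int_B la : 0 <= la ->
  intP (fun w => V w * pos_part (la ^+ 2 - (V w / 2) ^+ 2)).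
Proof.
move=> la0; apply: (@int_le (la ^+ 2)).
  apply: measurable_funM => //; apply: measurable_maxr => //.
  apply: measurable_funB => //.
  by apply: measurable_funX; apply: measurable_funM.
move=> w; have V0 := V_ge0 w; rewrite /pos_part.
rewrite mulr_ge0 ?le_max ?lexx ?orbT//= mulrC ler_wpM2r// ge_max sqr_ge0 andbT.
by rewrite gerBl sqr_ge0.
Qed.

Let diffE (f g : T -> R) : intP f -> intP g ->
  mean P g - mean P f = \int[P]_w (g w - f w).
Proof. by move=> *; rewrite !mean_Rintegral RintegralB. Qed.

Let intB (f g : T -> R) : intP f -> intP g -> intP (fun w => g w - f w).
Proof. by move=> fi gi; exact: (integrableB measurableT gi fi). Qed.

Let intZ c (f : T -> R) : intP f -> intP (fun w => c * f w).
Proof. by move=> fi; exact: (integrableZl measurableT c fi). Qed.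

Lemma A_0 : A P V 0 = 0.
Proof.
rewrite /A mean_Rintegral -[RHS](mul0r (fine (P setT))) -(Rintegral_cst P)//.
apply: eq_Rintegral => w _; rewrite /pos_part max_r ?mulr0//.
by rewrite sub0r oppr_le0 divr_ge0.
Qed.

Lemma B_0 : B P V 0 = 0.
Proof.
rewrite /B mean_Rintegral -[RHS](mul0r (fine (P setT))) -(Rintegral_cst P)//.
apply: eq_Rintegral => w _; rewrite /pos_part max_r ?mulr0//.
by rewrite expr0n sub0r oppr_le0 sqr_ge0.
Qed.

Lemma A_incr x y : 0 <= x -> x <= y ->
  0 <= A P V y - A P V x <= mean P V * (y - x).
Proof.
move=> x0 xy; have y0 := le_trans x0 xy.
rewrite /A diffE ?int_A//; apply/andP; split.
  apply: Rintegral_ge0 => w _; rewrite -mulrBr mulr_ge0//.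
  by case/andP: (pos_part_incr (V w / 2) xy).
rewrite mean_Rintegral mulrC -RintegralZl//.
apply: le_Rintegral => //; [by apply: intB; exact: int_A|exact: intZ|].
move=> w _; rewrite -mulrBr mulrC ler_wpM2r//.
by case/andP: (pos_part_incr (V w / 2) xy).
Qed.

Lemma B_incr x y : 0 <= x -> x <= y ->
  2 * x * (A P V y - A P V x) <= B P V y - B P V x
                              <= 2 * y * (A P V y - A P V x).
Proof.
move=> x0 xy; have y0 := le_trans x0 xy.
have iAx := int_A x0; have iAy := int_A y0.
have iBx := int_B x0; have iBy := int_B y0.
have iA := intB iAx iAy; have iB := intB iBx iBy.
rewrite /A /B !diffE// -!RintegralZl//.
have v0 w : 0 <= V w / 2 by rewrite divr_ge0.
apply/andP; split; apply: le_Rintegral => //; try exact: intZ;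
  move=> w _; rewrite -!mulrBr mulrCA ler_wpM2l//;
  by case/andP: (pos_part_sqr_incr x0 xy (v0 w)).
Qed.

(** A positive part dominates its argument, and [V (x - V / 2)] integrates to the left-hand side.
    This supplies the linear growth [A_lb]. *)
Lemma A_lower_bound x : 0 <= x ->
  mean P V * x - mean P (fun w => V w ^+ 2) / 2 <= A P V x.
Proof.
move=> x0; rewrite /A !mean_Rintegral mulrC [_ / 2]mulrC -!RintegralZl//.
rewrite -RintegralB//; [|exact: intZ|exact: intZ].
apply: le_Rintegral => //; [|exact: int_A|].
  by apply: intB; exact: intZ.
move=> w _; apply: (@le_trans _ _ (V w * (x - V w / 2))).
  by rewrite expr2; lra.
by rewrite ler_wpM2l// /pos_part le_max lexx.
Qed.

Lemma mean_gt0 : {ae P, forall w, 0 < V w} -> 0 < mean P V.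
Proof.
move=> V0; rewrite lt_neqAle; apply/andP; split; last first.
  by rewrite mean_Rintegral; apply: Rintegral_ge0.
apply/eqP => /esym EV0.
have /(ae_eq_integral_abs P measurableT) : measurable_fun setT (EFin \o V).
  exact/measurable_EFinP.
case=> + _; rewrite (_ : (\int[P]_w `|(EFin \o V) w|)%E = 0%E); last first.
  rewrite -[RHS]/(0%:E) -EV0 mean_Rintegral fineK; last first.
    exact: integrable_fin_num int_V.
  by apply: eq_integral => w _ /=; rewrite ger0_norm.
move=> /(_ erefl) Vae0.
(* A zero mean makes [V] vanish almost everywhere; with [V > 0] almost everywhere the whole space
   would be negligible, against [P setT = 1]. *)
have : {ae P, forall w, False}.
  apply: filterS2 V0 Vae0 => w Vw /(_ Logic.I) [] Vw0.
  by rewrite Vw0 ltxx in Vw.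
move=> [N [_ PN0 NT]].
have {}NT : N = setT by apply/seteqP; split=> // w _; exact: NT.
by move/eqP: PN0; rewrite NT probability_setT onee_eq0.
Qed.

Lemma sqr_mean_ge0 : 0 <= mean P (fun w => V w ^+ 2).
Proof.
by rewrite mean_Rintegral; apply: Rintegral_ge0 => w _; exact: sqr_ge0.
Qed.

End moments.

(** * Application to the cost functional *)

Theorem theorem3 (disp : measure_display) (T : measurableType disp)
  (R : realType) (P : probability T R) (F : R -> set (set T))
  (J : R -> T -> R) (nu : {measure set (measurableTypeR R) -> \bar R})
  (tau : T -> \bar R) (zeta : probability (measurableTypeR R) R)
  (rho mu r h K d : R)
  (hF : usual_filtration P F)
  (hJ : subordinator P F J)
  (hnu : levy_measure P J nu)
  (hrho : ('E_P[J 1%R] = rho%:E)%E)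
  (htau : stopping_time F tau)
  (Etau_fin : (\int[P]_w tau w < +oo)%E)
  (V_gt0 : {ae P, forall w, 0 < stopped J tau w})
  (EV2_fin : ('E_P[fun w => (stopped J tau w ^+ 2)%R] < +oo)%E)
  (hmu : mu%:E = (((2 * rho)^-1)%:E *
                  \int[nu]_(x in [set` `]0%R, +oo[]) (x ^+ 2)%:E)%E)
  (mu_gt0 : 0 < mu)
  (h_gt0 : 0 < h) (K_gt0 : 0 < K) (d_gt0 : 0 < d)
  (rho_lt_r : rho < r)
  (hzeta : off_period_law P J tau zeta) :
  let V := stopped J tau in
  let G := G P V tau zeta rho mu r h K d in
  let lambda_star := lambda_star P V tau zeta rho mu r h K d in
  [/\ absolutely_continuous_on [set` `[0, +oo[] G,
      unimodal G
    & exists2 m, m \in `[0, lambda_star] &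
        forall la, 0 <= la -> G m <= G la].
Proof.
move=> V G0 lambda_star.
have mV : measurable_fun setT V := measurable_stopped hF hJ htau.
have V_ge0 : forall w, 0 <= V w := stopped_ge0 hJ htau.
(* If [rho <= 0], the prefactor [(2 * rho)^-1] is nonpositive (0 when [rho = 0]), and [hmu] would
   force [mu <= 0]. *)
have rho_gt0 : 0 < rho.
  rewrite ltNge; apply/negP => rho_le0.
  move: mu_gt0; rewrite -lte_fin hmu ltNge => /negP; apply.
  apply: mule_le0_ge0; first by rewrite lee_fin invr_le0 mulr_ge0_le0.
  by apply: integral_ge0 => x _; rewrite lee_fin sqr_ge0.
have rr : 0 < r - rho by rewrite subr_gt0.
have EV_gt0 : 0 < mean P V by exact: mean_gt0.
pose k := (2 * mu * rho)^-1.
have k_gt0 : 0 < k by rewrite invr_gt0 !mulr_gt0.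
have K2_ge0 : 0 <= K2 rho mu r h d.
  by rewrite addr_ge0// ?mulr_ge0 ?invr_ge0 ?(ltW rr)// ltW// !mulr_gt0.
(* Strictness comes from the term [mean P V / (r - rho)]. *)
have K3_gt0 : 0 < K3 P V tau rho r.
  rewrite ltr_wpDl ?divr_gt0// fine_ge0//.
  by apply: integral_ge0 => w _; exact: htau.1.
have s_ge0 : 0 <= mean P (fun w => V w ^+ 2) / 2.
  by rewrite divr_ge0// sqr_mean_ge0.
pose c1 := K1 P V tau zeta rho mu r h K d.
(* Factoring out [k] turns [K2 / (2 mu rho)] into [K2 * k] and [h / (4 mu rho)] into [h / 2 * k],
   the shape of the abstract ratio. *)
have G0E : G0 = fun x =>
    (c1 + K2 rho mu r h d * k * A P V x + h / 2 * k * B P V x) /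
    (K3 P V tau rho r + k * A P V x).
  apply/funext => x; rewrite /G0 /G /k; congr (_ / _).
    by congr (_ + _ + _ * _); field; rewrite !gt_eqF.
  by congr (_ + _); rewrite mulrC.
have A0 : A P V 0 = 0 by exact: A_0.
have B0 : B P V 0 = 0 by exact: B_0.
have Ai := A_incr mV V_ge0 EV2_fin.
have Bi := B_incr mV V_ge0 EV2_fin.
have Al := A_lower_bound mV V_ge0 EV2_fin.
have [M G_lip] := cost_ratio_lipschitz c1 k_gt0 K2_ge0 K3_gt0 h_gt0 EV_gt0
  s_ge0 A0 B0 Ai Bi Al.
have [m /andP[m0 mL]] := exists_turning_point c1 (K2 rho mu r h d) k_gt0 K3_gt0
  h_gt0 A0 B0 Ai Bi.
move=> -[Gl Gr]; rewrite G0E; split.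
- apply: (@lipschitz_absolutely_continuous_on _ _ _ M) => x y /=.
  by rewrite !in_itv/= !andbT => x0 _ xy; exact: G_lip.
- by exists m.
- exists m; first by rewrite in_itv/= m0.
  move=> la la0; have [lam|/ltW mla] := leP la m.
    by apply: Gl => //; rewrite in_itv/= ?la0 ?m0 ?lexx.
  by apply: Gr => //; rewrite in_itv/= andbT.
Qed.
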